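(* Assume that the noise assumptions (A1) and (A2) of the context hold, and run the same-sample stochastic extragradient iteration (SEG) of the context from $(\mathbf{x}_0,\mathbf{y}_0)$ with constant step size $\eta=\eta_{\mathbf{M}}/\sqrt2$. Then for all integers $K\ge1$, $$\mathbb{E}\left[\|\mathbf{x}_K\|^2+\|\mathbf{y}_K\|^2\right]\le e^{-\frac{\eta_{\mathbf{M}}^2}{4}\cdot(\lambda_{\min}(\mathbf{M})\wedge\lambda_{\min}(\widehat{\mathbf{M}}))\cdot K}\left[\|\mathbf{x}_0\|^2+\|\mathbf{y}_0\|^2\right]+\frac{3\sigma_{\mathbf{g}}^2}{\lambda_{\min}(\mathbf{M})\wedge\lambda_{\min}(\widehat{\mathbf{M}})}.$$
   Context: Notation: $a\wedge b=\min(a,b)$, $a\vee b=\max(a,b)$; $\lambda_{\max},\lambda_{\min}$ are the largest and smallest eigenvalues of a real symmetric matrix; $\|\cdot\|$ is the Euclidean norm, $\|\cdot\|_{op}$ the operator norm. Data: a random triple $(\mathbf{B}_\xi,\mathbf{g}^{\mathbf{x}}_\xi,\mathbf{g}^{\mathbf{y}}_\xi)$ with values in $\mathbb{R}^{n\times m}\times\mathbb{R}^n\times\mathbb{R}^m$; $\mathbb{E}_\xi$ is expectation over it. For $t\ge1$, $(\mathbf{B}_{\xi,t},\mathbf{g}^{\mathbf{x}}_{\xi,t},\mathbf{g}^{\mathbf{y}}_{\xi,t})$ are i.i.d. copies; $(\mathbf{x}_0,\mathbf{y}_0)\in\mathbb{R}^n\times\mathbb{R}^m$ is deterministic. Put $\mathbf{B}=\mathbb{E}_\xi[\mathbf{B}_\xi]$,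 $\mathbf{M}_\xi=\mathbf{B}_\xi\mathbf{B}_\xi^\top$, $\widehat{\mathbf{M}}_\xi=\mathbf{B}_\xi^\top\mathbf{B}_\xi$, $\mathbf{M}=\mathbb{E}_\xi\mathbf{M}_\xi$, $\widehat{\mathbf{M}}=\mathbb{E}_\xi\widehat{\mathbf{M}}_\xi$. (A1) $\lambda_{\max}(\mathbf{B}^\top\mathbf{B})>0$, $\lambda_{\min}(\mathbf{M})\wedge\lambda_{\min}(\widehat{\mathbf{M}})>0$, and $\sigma_{\mathbf{B}},\sigma_{\mathbf{B},2}\in[0,\infty)$ are such that $\|\mathbb{E}_\xi[(\mathbf{B}_\xi-\mathbf{B})^\top(\mathbf{B}_\xi-\mathbf{B})]\|_{op}\le\sigma_{\mathbf{B}}^2$, $\|\mathbb{E}_\xi[(\mathbf{B}_\xi-\mathbf{B})(\mathbf{B}_\xi-\mathbf{B})^\top]\|_{op}\le\sigma_{\mathbf{B}}^2$, $\|\mathbb{E}_\xi[(\widehat{\mathbf{M}}_\xi-\widehat{\mathbf{M}})^2]\|_{op}\le\sigma_{\mathbf{B},2}^2$, $\|\mathbb{E}_\xi[(\mathbf{M}_\xi-\mathbf{M})^2]\|_{op}\le\sigma_{\mathbf{B},2}^2$. (A2) $\sigma_{\mathbf{g}}\in[0,\infty)$ is such that $\mathbb{E}_\xi[\|\mathbf{g}^{\mathbf{x}}_\xi\|^2+\|\mathbf{g}^{\mathbf{y}}_\xi\|^2]\le\sigma_{\mathbf{g}}^2$; $\mathbb{E}_\xi[\mathbf{g}^{\mathbf{x}}_\xi]=\mathbf{0}$,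 $\mathbb{E}_\xi[\mathbf{g}^{\mathbf{y}}_\xi]=\mathbf{0}$; and $\mathbf{B}_\xi$ is independent of $[\mathbf{g}^{\mathbf{x}}_\xi;\mathbf{g}^{\mathbf{y}}_\xi]$. (SEG) With constant step size $\eta$, for $t\ge1$: $\mathbf{x}_{t-1/2}=\mathbf{x}_{t-1}-\eta[\mathbf{B}_{\xi,t}\mathbf{y}_{t-1}+\mathbf{g}^{\mathbf{x}}_{\xi,t}]$, $\mathbf{y}_{t-1/2}=\mathbf{y}_{t-1}+\eta[\mathbf{B}_{\xi,t}^\top\mathbf{x}_{t-1}+\mathbf{g}^{\mathbf{y}}_{\xi,t}]$, $\mathbf{x}_t=\mathbf{x}_{t-1}-\eta[\mathbf{B}_{\xi,t}\mathbf{y}_{t-1/2}+\mathbf{g}^{\mathbf{x}}_{\xi,t}]$, $\mathbf{y}_t=\mathbf{y}_{t-1}+\eta[\mathbf{B}_{\xi,t}^\top\mathbf{x}_{t-1/2}+\mathbf{g}^{\mathbf{y}}_{\xi,t}]$. Maximal step size: $\eta_{\mathbf{M}}=1/\sqrt{\rho_1\vee\rho_2}$ with $\rho_1=\lambda_{\max}(\mathbf{M}^{-1/2}[\mathbb{E}_\xi\mathbf{M}_\xi^2]\mathbf{M}^{-1/2})$, $\rho_2=\lambda_{\max}(\widehat{\mathbf{M}}^{-1/2}[\mathbb{E}_\xi\widehat{\mathbf{M}}_\xi^2]\widehat{\mathbf{M}}^{-1/2})$. *)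

(* Defs.v *)
From HB Require Import structures.
From mathcomp Require Import all_boot all_order all_algebra.
From mathcomp Require Import all_classical all_reals all_analysis.

Set Implicit Arguments.
Unset Strict Implicit.
Unset Printing Implicit Defensive.

Import Order.TTheory GRing.Theory Num.Theory.
Import numFieldNormedType.Exports.

Local Open Scope classical_set_scope.
Local Open Scope ring_scope.

Section matrix_measurable.
Context d (T : measurableType d) (p q : nat).

(* Product sigma-algebra, generated by the entries. For T a realType with its
   Borel sets, this is the Borel sigma-algebra of the matrix space. *)
Definition mx_measurable : set (set 'M[T]_(p, q)) :=
  <<s \bigcup_(ij in [set: 'I_p * 'I_q])
        preimage_set_system setT (fun A : 'M[T]_(p, q) => A ij.1 ij.2)
          (@measurable d T) >>.

Let mx_measurable0 : mx_measurable set0.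
Proof. exact: sigma_algebra0. Qed.

Let mx_measurableC (A : set 'M[T]_(p, q)) :
  mx_measurable A -> mx_measurable (~` A).
Proof. by move=> mA; rewrite -setTD; exact: sigma_algebraCD. Qed.

Let mx_measurable_bigcup (F : (set 'M[T]_(p, q))^nat) :
  (forall i, mx_measurable (F i)) -> mx_measurable (\bigcup_i F i).
Proof. exact: sigma_algebra_bigcup. Qed.

Definition measure_mx_display (e : measure_display) : measure_display.
Proof. exact: e. Qed.

HB.instance Definition _ := @isMeasurable.Build (measure_mx_display d)
  'M[T]_(p, q) mx_measurable mx_measurable0 mx_measurableC
  mx_measurable_bigcup.

End matrix_measurable.

Section linear_algebra.
Context {R : realType}.
Implicit Types p q : nat.

(* The set of eigenvalues of a real symmetric matrix of positive size is finite
   and nonempty, so that the supremum and infimum are attained. *)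
Definition lambda_max p (A : 'M[R]_p) : R := sup [set a | eigenvalue A a].
Definition lambda_min p (A : 'M[R]_p) : R := inf [set a | eigenvalue A a].

(* The library norm on matrices is the maximum norm. *)
Definition enorm p (x : 'cV[R]_p) : R := Num.sqrt (\sum_i x i 0 ^+ 2).

Definition opnorm p q (A : 'M[R]_(p, q)) : R :=
  sup [set enorm (A *m x) | x in [set x : 'cV[R]_q | enorm x <= 1]].

Definition psdmx p (A : 'M[R]_p) : Prop :=
  A^T = A /\ forall x : 'cV[R]_p, 0 <= (x^T *m A *m x) 0 0.

(* The positive semidefinite square root, unique when it exists, i.e. when A is
   itself positive semidefinite. *)
Definition sqrtmx p (A : 'M[R]_p) : 'M[R]_p :=
  xget 0 [set S | psdmx S /\ S *m S = A].

Definition invsqrtmx p (A : 'M[R]_p) : 'M[R]_p := invmx (sqrtmx A).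

End linear_algebra.

Section probability_notions.
Context {R : realType}.

(* Entries that are not integrable have a meaningless mean: to be used together
   with mx_integrable. *)
Definition mx_expect d (T : measurableType d) (P : probability T R) p q
    (X : T -> 'M[R]_(p, q)) : 'M[R]_(p, q) :=
  \matrix_(i, j) fine 'E_P[fun w => X w i j].

Definition mx_integrable d (T : measurableType d) (P : probability T R) p q
    (X : T -> 'M[R]_(p, q)) : Prop :=
  forall i j, P.-integrable setT (fun w => (X w i j)%:E).

Definition independent d d1 d2 (T : measurableType d) (P : probability T R)
    (T1 : measurableType d1) (T2 : measurableType d2)
    (X : T -> T1) (Y : T -> T2) : Prop :=
  forall A C, measurable A -> measurable C ->
    P (X @^-1` A `&` Y @^-1` C) = (P (X @^-1` A) * P (Y @^-1` C))%E.

Definition mutually_independent d d' (T : measurableType d)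
    (P : probability T R) (T' : measurableType d')
    (D : set nat) (Z : nat -> T -> T') : Prop :=
  forall (J : seq nat) (A : nat -> set T'),
    uniq J -> [set` J] `<=` D -> (forall t, measurable (A t)) ->
    P (\bigcap_(t in [set` J]) (Z t @^-1` A t)) =
      (\prod_(t <- J) P (Z t @^-1` A t))%E.

(* The Z t with t in D are i.i.d. copies of X, which may live on another
   probability space. *)
Definition iid_copies d0 d d' (T0 : measurableType d0) (P0 : probability T0 R)
    (T : measurableType d) (P : probability T R) (T' : measurableType d')
    (X : T0 -> T') (D : set nat) (Z : nat -> T -> T') : Prop :=
  mutually_independent P D Z /\
  forall t, D t -> forall A, measurable A -> P (Z t @^-1` A) = P0 (X @^-1` A).

End probability_notions.

Section extragradient.
Context {R : realType} {n m : nat}.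

Definition gram (B : 'M[R]_(n, m)) : 'M[R]_n := B *m B^T.
Definition gramhat (B : 'M[R]_(n, m)) : 'M[R]_m := B^T *m B.

Definition sqrmx p (A : 'M[R]_p) : 'M[R]_p := A *m A.

Section data.
Context d (T : measurableType d) (P : probability T R).
Variables (Bxi : T -> 'M[R]_(n, m)) (gx : T -> 'cV[R]_n) (gy : T -> 'cV[R]_m).

Definition meanB : 'M[R]_(n, m) := mx_expect P Bxi.
Definition meanM : 'M[R]_n := mx_expect P (fun w => gram (Bxi w)).
Definition meanMhat : 'M[R]_m := mx_expect P (fun w => gramhat (Bxi w)).

Definition lambda_minM : R :=
  Num.min (lambda_min meanM) (lambda_min meanMhat).

(* The integrability fields make all the matrix expectations meaningful; those
   of the centered matrices are integrable as a consequence. *)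
Record noise_B (sB sB2 : R) : Prop := NoiseB {
  integrable_B : mx_integrable P Bxi;
  integrable_M : mx_integrable P (fun w => gram (Bxi w));
  integrable_Mhat : mx_integrable P (fun w => gramhat (Bxi w));
  integrable_sqrM : mx_integrable P (fun w => sqrmx (gram (Bxi w)));
  integrable_sqrMhat : mx_integrable P (fun w => sqrmx (gramhat (Bxi w)));
  lambda_maxB_gt0 : 0 < lambda_max (meanB^T *m meanB);
  lambda_minM_gt0 : 0 < lambda_minM;
  sB_ge0 : 0 <= sB;
  sB2_ge0 : 0 <= sB2;
  var_Bhat :
    opnorm (mx_expect P (fun w => gramhat (Bxi w - meanB))) <= sB ^+ 2;
  var_B : opnorm (mx_expect P (fun w => gram (Bxi w - meanB))) <= sB ^+ 2;
  var_Mhat :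
    opnorm (mx_expect P (fun w => sqrmx (gramhat (Bxi w) - meanMhat)))
      <= sB2 ^+ 2;
  var_M :
    opnorm (mx_expect P (fun w => sqrmx (gram (Bxi w) - meanM))) <= sB2 ^+ 2
}.

Record noise_g (sg : R) : Prop := NoiseG {
  sg_ge0 : 0 <= sg;
  var_g : ('E_P[fun w => (enorm (gx w) ^+ 2 + enorm (gy w) ^+ 2)%R]
             <= (sg ^+ 2)%:E)%E;
  mean_gx : mx_expect P gx = 0;
  mean_gy : mx_expect P gy = 0;
  indep_B_g : independent P Bxi (fun w => (gx w, gy w))
}.

Definition rho1 : R :=
  lambda_max (invsqrtmx meanM
    *m mx_expect P (fun w => sqrmx (gram (Bxi w))) *m invsqrtmx meanM).

Definition rho2 : R :=
  lambda_max (invsqrtmx meanMhat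
    *m mx_expect P (fun w => sqrmx (gramhat (Bxi w))) *m invsqrtmx meanMhat).

Definition eta_max : R := 1 / Num.sqrt (Num.max rho1 rho2).

End data.

Definition seg_step (eta : R) (B : 'M[R]_(n, m)) (gx : 'cV[R]_n)
    (gy : 'cV[R]_m) (z : 'cV[R]_n * 'cV[R]_m) : 'cV[R]_n * 'cV[R]_m :=
  let: (x, y) := z in
  let xhalf := x - eta *: (B *m y + gx) in
  let yhalf := y + eta *: (B^T *m x + gy) in
  (x - eta *: (B *m yhalf + gx), y + eta *: (B^T *m xhalf + gy)).

(* Step t uses the sample of index t; the sample of index 0 is never used. *)
Fixpoint seg T (eta : R) (B : nat -> T -> 'M[R]_(n, m))
    (gx : nat -> T -> 'cV[R]_n) (gy : nat -> T -> 'cV[R]_m)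
    (x0 : 'cV[R]_n) (y0 : 'cV[R]_m) (t : nat) (w : T) :
    'cV[R]_n * 'cV[R]_m :=
  if t is s.+1 then
    seg_step eta (B t w) (gx t w) (gy t w) (seg eta B gx gy x0 y0 s w)
  else (x0, y0).

End extragradient.

(* Main.v *)
From HB Require Import structures.
Require Import Defs.
From mathcomp Require Import all_boot all_order all_algebra.
From mathcomp Require Import all_classical all_reals all_analysis.
From mathcomp Require Import measurable_realfun complex ring lra.
Set Implicit Arguments.
Unset Strict Implicit.
Unset Printing Implicit Defensive.
Import Order.TTheory GRing.Theory Num.Theory.
Import numFieldNormedType.Exports.
Local Open Scope classical_set_scope.
Local Open Scope ring_scope.

(** Write [|z|^2 = |x|^2 + |y|^2] for the energy of a state [z = (x, y)]; write
M and Mh for the means of [B B^T] and [B^T B], Q and Qh for the means of their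
squares, lam for the least eigenvalue of M or Mh, whichever is smaller, and rho
for the maximum of rho1 and rho2. The theorem is a drift inequality for the energy, iterated
along the Markov chain z.

Without the additive noise, one step maps (x, y) to
[(x - eta^2 B B^T x - eta B y, y - eta^2 B^T B y + eta B^T x)]. The terms that
couple x and y cancel in the energy of this point ([energy_seg_step0]), whose
mean is therefore
[|z|^2 - eta^2 (x.Mx + y.Mhy) + eta^4 (x.Qx + y.Qhy)].
The definition of rho1 and rho2 says precisely that [x.Qx <= rho x.Mx] and
[y.Qhy <= rho y.Mhy] ([rayleigh_quotient_le]). As [eta^2 rho = 1/2], at least
half of the decrease survives, that is, at least [(eta^2 / 2) lam |z|^2].

The additive noise g = (gx, gy) enters a step affinely. Its linear
contribution vanishes because g is centered and independent of B. Its
quadratic contribution is [eta^2 |g|^2 + eta^4 (|B^T gx|^2 + |B gy|^2)], again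
without cross terms, and the mean of the second part is at most
[eta^4 rho |g|^2]: indeed [M^2 <= Q <= rho M] implies [M <= rho]
([mean_le_rho]). Hence the noise adds at most [(3/2) eta^2 sg^2]
([energy_step_mean_le]).

Since z_t depends on the samples 1, ..., t only, it is independent of the
sample t+1 ([chain_indep_next]), so the one-step bound may be integrated
against the law of z_t ([chain_next_le]). This gives
[E_(t+1) <= (1 - a) E_t + a c] with [a = eta_M^2 lam / 4] and
[c = 3 sg^2 / lam]. Hence [E_K <= (1 - a)^K E_0 + c], and
[1 - a <= exp (- a)].

The terms that are linear in the noise are cubic in the entries of B. They are
removed by integrating over the noise first, for a fixed B; the double integrals
that remain are integrals of nonnegative functions, to which the theorem of
Tonelli applies. *)

(** * Scalar products *)

Definition dot {R : pzRingType} {p} (u v : 'cV[R]_p) : R := (u^T *m v) 0 0.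

Section dot.
Context {R : realType}.

Lemma dotE p (u v : 'cV[R]_p) : dot u v = \sum_i u i 0 * v i 0.
Proof. by rewrite /dot mxE; apply: eq_bigr => i _; rewrite mxE. Qed.

Lemma dotC p (u v : 'cV[R]_p) : dot u v = dot v u.
Proof. by rewrite !dotE; apply: eq_bigr => i _; rewrite mulrC. Qed.

Lemma dotDr p (u v w : 'cV[R]_p) : dot u (v + w) = dot u v + dot u w.
Proof. by rewrite /dot mulmxDr mxE. Qed.

Lemma dotZr p (u v : 'cV[R]_p) a : dot u (a *: v) = a * dot u v.
Proof. by rewrite /dot -scalemxAr mxE. Qed.

Lemma dotNr p (u v : 'cV[R]_p) : dot u (- v) = - dot u v.
Proof. by rewrite -scaleN1r dotZr mulN1r. Qed.

Lemma dotDl p (u v w : 'cV[R]_p) : dot (v + w) u = dot v u + dot w u.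
Proof. by rewrite dotC dotDr !(dotC u). Qed.

Lemma dotZl p (u v : 'cV[R]_p) a : dot (a *: v) u = a * dot v u.
Proof. by rewrite dotC dotZr dotC. Qed.

Lemma dotNl p (u v : 'cV[R]_p) : dot (- v) u = - dot v u.
Proof. by rewrite dotC dotNr dotC. Qed.

Lemma dot0r p (u : 'cV[R]_p) : dot u 0 = 0.
Proof. by rewrite /dot mulmx0 mxE. Qed.

Lemma dot_mull p q (A : 'M[R]_(p, q)) u v : dot (A *m u) v = dot u (A^T *m v).
Proof. by rewrite /dot trmx_mul mulmxA. Qed.

Lemma dot_ge0 p (u : 'cV[R]_p) : 0 <= dot u u.
Proof. by rewrite dotE sumr_ge0 // => i _; rewrite -expr2 sqr_ge0. Qed.

Lemma dot_eq0 p (u : 'cV[R]_p) : dot u u = 0 -> u = 0.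
Proof.
rewrite dotE => /psumr_eq0P u0; apply/colP => i; rewrite mxE; apply/eqP.
by rewrite -sqrf_eq0 expr2 u0 // => j _; rewrite -expr2 sqr_ge0.
Qed.

Lemma enorm2E p (u : 'cV[R]_p) : enorm u ^+ 2 = dot u u.
Proof.
rewrite /enorm sqr_sqrtr; last by rewrite sumr_ge0 // => i _; rewrite sqr_ge0.
by rewrite dotE; apply: eq_bigr => i _; rewrite expr2.
Qed.

Lemma entry_sqr_le p (u : 'cV[R]_p) i : u i 0 ^+ 2 <= dot u u.
Proof.
rewrite dotE (bigD1 i) //= -expr2 lerDl sumr_ge0 // => j _.
by rewrite -expr2 sqr_ge0.
Qed.

End dot.

(** * Spectral theory of real symmetric matrices *)

(** The spectral theorem in the only form that is used below: a real symmetric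
matrix is annihilated by every polynomial that vanishes at its eigenvalues. The
matrix is diagonalized over the complex numbers, where it is Hermitian, so that
its eigenvalues are real; the identity descends to the reals since the
embedding is injective. *)
Lemma sym_horner_eq0 (R : realType) n (A : 'M[R]_n.+1) : A^T = A ->
  exists2 r : seq R, all (eigenvalue A) r &
    forall p : {poly R}, all (root p) r -> horner_mx A p = 0.
Proof.
move=> symA; pose f := real_complex R; pose A' := map_mx f A.
have hA : A' \is hermsymmx.
  apply: realsym_hermsym.
    apply/is_hermitianmxP; rewrite expr0 scale1r (map_mx_id (fun=> erefl)).
    by rewrite /A' map_trmx symA.
  apply/mxOverP => i j; rewrite mxE.
  by apply/complex_realP; exists (A i j).
have /mxOverP dreal := hermitian_spectral_diag_real hA.
have dE := orthomx_spectralP (hermitian_normalmx hA).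
have Uunit := spectral_unit A'.
set U := spectralmx A' in dE Uunit; set D := spectral_diag A' in dE dreal.
have dR i : D 0 i = f (complex.Re (D 0 i)) by rewrite /f RRe_real.
have pE (p : {poly R}) : map_mx f (horner_mx A p) =
    invmx U *m diag_mx (map_mx (horner (map_poly f p)) D) *m U.
  rewrite map_horner_mx -/A'.
  rewrite [in LHS]dE.
  rewrite (horner_mx_uconjC _ _ Uunit).
  rewrite (horner_mx_diag D (map_poly f p)).
  reflexivity.
exists [seq complex.Re (D 0 i) | i <- enum 'I_n.+1]; last first.
  move=> p /allP p0.
  suff h : map_mx f (horner_mx A p) = 0.
    apply/matrixP => a b; move/matrixP/(_ a b): h; rewrite !mxE => /eqP.
    by rewrite fmorph_eq0 => /eqP.
  rewrite pE.
  suff -> : map_mx (horner (map_poly f p)) D = 0.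
    by rewrite raddf0 mulmx0 mul0mx.
  apply/rowP => i; rewrite !mxE dR horner_map.
  by rewrite (rootP (p0 _ (map_f _ _))) ?mem_enum // rmorph0.
apply/allP => x /mapP[i _ ->].
suff : eigenvalue A' (D 0 i).
  rewrite !eigenvalue_root_char [D 0 i]dR -map_char_poly.
  by rewrite fmorph_root.
apply/eigenvalueP; exists (delta_mx 0 i *m U).
  rewrite {1}dE !mulmxA mulmxK //.
  by rewrite -(rowE i (diag_mx D)) row_diag_mx -scalemxAl.
apply/negP => /eqP /(congr1 (mulmx^~ (invmx U))).
rewrite mulmxK // mul0mx => /matrixP/(_ 0 i); rewrite !mxE !eqxx => /eqP.
by rewrite oner_eq0.
Qed.

Lemma interpolation (F : fieldType) (r : seq F) (f : F -> F) :
  exists p : {poly F}, {in r, forall x, p.[x] = f x}.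
Proof.
elim: r => [|y r [p pf]]; first by exists 0.
have [yr|yr] := boolP (y \in r).
  exists p => x; rewrite inE => /orP[/eqP->|xr]; first exact: (pf y yr).
  exact: (pf x xr).
pose w := \prod_(x <- r) ('X - x%:P).
exists (p + ((f y - p.[y]) / w.[y]) *: w) => x; rewrite inE !hornerE.
have [->{x} _|xy /= xr] := eqVneq x y.
  have wy : w.[y] != 0 by rewrite -[_ == 0]/(root w y) root_prod_XsubC.
  by rewrite (divfK wy) addrC subrK.
have /rootP -> : root w x by rewrite root_prod_XsubC.
by rewrite mulr0 addr0 (pf x xr).
Qed.

Section symmetric.
Context {R : realType}.

(** Functional calculus: any function f of a symmetric matrix A is a polynomial
in A, namely one that interpolates f at the eigenvalues. Only the equation
[Q^k = g(A)], inherited from [f^k = g], is recorded. *)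
Lemma sym_funcalc n (A : 'M[R]_n.+1) (f : R -> R) (g : {poly R}) k :
  A^T = A -> (forall a, eigenvalue A a -> f a ^+ k = g.[a]) ->
  exists2 Q : 'M[R]_n.+1, Q^T = Q & Q ^+ k = horner_mx A g.
Proof.
move=> symA fg; have [r /allP rA r0] := sym_horner_eq0 symA.
have [q qf] := interpolation r f; exists (horner_mx A q).
  elim/poly_ind: q {qf} => [|q c IHq]; first by rewrite rmorph0 trmx0.
  rewrite rmorphD rmorphM /= horner_mx_X horner_mx_C linearD /= tr_scalar_mx.
  congr (_ + _); rewrite [LHS]trmx_mul IHq symA.
  by apply: esym; apply: comm_horner_mx.
rewrite -rmorphXn /=; apply/eqP; rewrite -subr_eq0 -raddfB; apply/eqP/r0.
apply/allP => x xr; apply/rootP.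
by rewrite !hornerE qf // fg ?subrr // rA.
Qed.

(** If g is nonnegative on the spectrum, then g(A) is the square of a symmetric
matrix. *)
Lemma sym_horner_ge0 n (A : 'M[R]_n.+1) (g : {poly R}) x :
  A^T = A -> (forall a, eigenvalue A a -> 0 <= g.[a]) ->
  0 <= dot x (horner_mx A g *m x).
Proof.
move=> symA g0.
have [|Q symQ <-] := @sym_funcalc _ A (fun a => Num.sqrt g.[a]) g 2 symA.
  by move=> a /g0 ?; rewrite sqr_sqrtr.
by rewrite expr2 -mulmxA -{1}symQ -dot_mull dot_ge0.
Qed.

(** Needed for the infimum and the supremum in the definitions of the extreme
eigenvalues to be bounds of the spectrum. *)
Lemma sym_eigenvalue_bounded n (A : 'M[R]_n) : A^T = A ->
  exists b, forall a, eigenvalue A a -> `|a| <= b.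
Proof.
case: n A => [|n] A symA.
  by exists 0 => a; rewrite /eigenvalue (flatmx0 (eigenspace A a)) eqxx.
have [r _ r0] := sym_horner_eq0 symA.
exists (\sum_(x <- r) `|x|) => a.
rewrite eigenvalue_root_char -root_mxminpoly => /rootP a0.
have /mxminpoly_min : horner_mx A (\prod_(x <- r) ('X - x%:P)) = 0.
  by apply/r0/allP => x; rewrite root_prod_XsubC.
case/Pdiv.Field.dvdpP => q rE.
have : root (\prod_(x <- r) ('X - x%:P)) a.
  by apply/rootP; rewrite rE hornerM a0 mulr0.
rewrite root_prod_XsubC => ar.
by rewrite (big_rem a) //= lerDl sumr_ge0.
Qed.

(** The polynomial ['X - lambda_min A] is nonnegative on the spectrum. *)
Lemma lambda_min_le n (A : 'M[R]_n) x : A^T = A ->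
  lambda_min A * dot x x <= dot x (A *m x).
Proof.
move=> symA; have [b bA] := sym_eigenvalue_bounded symA.
case: n A x symA bA => [|n] A x symA bA.
  by rewrite !dotE !big_ord0 mulr0.
have := @sym_horner_ge0 _ A ('X - (lambda_min A)%:P) x symA.
rewrite rmorphB /= horner_mx_X horner_mx_C mulmxBl mul_scalar_mx.
rewrite dotDr dotNr dotZr subr_ge0; apply => a aA; rewrite !hornerE subr_ge0.
apply: ge_inf aA; exists (- b) => c /= /bA.
by rewrite ler_norml => /andP[].
Qed.

Lemma lambda_max_ge n (A : 'M[R]_n) x : A^T = A ->
  dot x (A *m x) <= lambda_max A * dot x x.
Proof.
move=> symA; have [b bA] := sym_eigenvalue_bounded symA.
case: n A x symA bA => [|n] A x symA bA.
  by rewrite !dotE !big_ord0 mulr0.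
have := @sym_horner_ge0 _ A ((lambda_max A)%:P - 'X) x symA.
rewrite rmorphB /= horner_mx_X horner_mx_C mulmxBl mul_scalar_mx.
rewrite dotDr dotNr dotZr subr_ge0; apply => a aA; rewrite !hornerE subr_ge0.
apply: ub_le_sup aA; exists b => c /= /bA.
by rewrite ler_norml => /andP[].
Qed.

Lemma lambda_min0 (A : 'M[R]_0) : lambda_min A = 0.
Proof.
rewrite /lambda_min; set E := mkset _.
suff -> : E = set0 by rewrite inf0.
apply/seteqP; split=> // a.
by rewrite /E /= /eigenvalue (flatmx0 (eigenspace A a)) eqxx.
Qed.

(** The matrix [sqrtmx A] is chosen among the positive semidefinite square roots
of A, so that one of them has to be exhibited: the square of a symmetric fourth
root of A. *)
Lemma sqrtmxP n (A : 'M[R]_n) : A^T = A -> 0 < lambda_min A ->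
  psdmx (sqrtmx A) /\ sqrtmx A *m sqrtmx A = A.
Proof.
case: n A => [|n] A symA A0; first by rewrite lambda_min0 ltxx in A0.
suff [S SP] : [set S | psdmx S /\ S *m S = A] !=set0.
  by apply: (@xgetPex _ 0 [set S | psdmx S /\ S *m S = A]); exists S.
have [|Q symQ QA] :=
    @sym_funcalc _ A (fun a => Num.sqrt (Num.sqrt a)) 'X 4 symA.
  move=> a aA; rewrite (exprM _ 2 2) sqr_sqrtr ?sqrtr_ge0 //.
  rewrite sqr_sqrtr ?hornerX //.
  have /eigenvalueP[v vA v0] := aA.
  have := lambda_min_le v^T symA.
  have E : A *m v^T = a *: v^T.
    by rewrite -{1}symA -trmx_mul vA linearZ.
  have : 0 < dot v^T v^T.
    rewrite lt_neqAle dot_ge0 andbT eq_sym; apply: contra_neq v0 => /dot_eq0.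
    by move/(congr1 trmx); rewrite trmxK trmx0.
  rewrite E dotZr => v1; rewrite (ler_pM2r v1); apply: le_trans; exact: ltW.
exists (Q ^+ 2); split; last by rewrite -[_ *m _]expr2 -exprM QA horner_mx_X.
split => [|x]; first by rewrite expr2 [LHS]trmx_mul symQ.
rewrite -mulmxA -/(dot x _) expr2 -[Q * Q *m x]mulmxA -{1}symQ.
by rewrite -dot_mull dot_ge0.
Qed.

(** With S the square root of M, the substitution [u = S x] turns the ratio
[x.Qx / x.Mx] into the Rayleigh quotient of [S^-1 Q S^-1] at u. *)
Lemma rayleigh_quotient_le n (M Q : 'M[R]_n) x :
    M^T = M -> Q^T = Q -> 0 < lambda_min M ->
  dot x (Q *m x) <=
    lambda_max (invsqrtmx M *m Q *m invsqrtmx M) * dot x (M *m x).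
Proof.
move=> symM symQ M0; have [[symS _] SM] := sqrtmxP symM M0.
set S := sqrtmx M in symS SM; rewrite /invsqrtmx -/S.
have Sunit : S \in unitmx.
  rewrite unitmxE unitfE; apply/det0P => -[v v0 vS].
  have := lambda_min_le v^T symM.
  have Sv0 : S *m v^T = 0 by rewrite -symS -trmx_mul vS trmx0.
  rewrite -{2}SM -mulmxA Sv0 mulmx0 dotC.
  rewrite {2}/dot trmx0 mul0mx [X in _ <= X -> _]mxE pmulr_rle0 //.
  move=> vv0; move/negP: v0; apply; apply/eqP.
  apply: trmx_inj; rewrite trmx0; apply: dot_eq0.
  by apply/eqP; rewrite eq_le vv0 dot_ge0.
have symV : (invmx S)^T = invmx S by rewrite trmx_inv symS.
have := @lambda_max_ge _ (invmx S *m Q *m invmx S) (S *m x) _.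
rewrite !trmx_mul symV symQ mulmxA => /(_ erefl).
rewrite dot_mull symS !mulmxA mulmxV // mul1mx mulmxKV //.
by rewrite dot_mull symS mulmxA SM.
Qed.

End symmetric.

(** * The energy of one extragradient step *)

Section energy.
Context {R : realType} {n m : nat}.
Implicit Types (B : 'M[R]_(n, m)) (z : 'cV[R]_n * 'cV[R]_m).

Definition energy z : R := dot z.1 z.1 + dot z.2 z.2.

Lemma energy_ge0 z : 0 <= energy z.
Proof. by rewrite addr_ge0 ?dot_ge0. Qed.

Definition gram_form B z : R :=
  dot z.1 (gram B *m z.1) + dot z.2 (gramhat B *m z.2).

Lemma gram_sym B : (gram B)^T = gram B.
Proof. by rewrite /gram trmx_mul trmxK. Qed.

Lemma gramhat_sym B : (gramhat B)^T = gramhat B.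
Proof. by rewrite /gramhat trmx_mul trmxK. Qed.

Lemma gram_form_ge0 B z : 0 <= gram_form B z.
Proof.
rewrite /gram_form /gram /gramhat -!mulmxA addr_ge0 //.
  by have := dot_ge0 (B^T *m z.1); rewrite dot_mull trmxK.
by have := dot_ge0 (B *m z.2); rewrite dot_mull.
Qed.

Lemma seg_stepE eta B gx gy z (a := seg_step eta B 0 0 z) :
  seg_step eta B gx gy z =
    (a.1 - (eta *: gx + eta ^+ 2 *: (B *m gy)),
     a.2 + (eta *: gy - eta ^+ 2 *: (B^T *m gx))).
Proof.
case: z @a => x y a; rewrite /a /= !addr0; congr (_, _).
  rewrite !(mulmxDr, =^~ scalemxAr, scalerDr).
  move: (B *m y) (B *m (B^T *m x)) (B *m gy) => u v w.
  by apply/colP => i; rewrite !mxE; ring.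
rewrite !(mulmxDr, mulmxN, =^~ scalemxAr, scalerDr, scalerN).
move: (B^T *m x) (B^T *m (B *m y)) (B^T *m gx) => u v w.
by apply/colP => i; rewrite !mxE; ring.
Qed.

(** The last line is linear in the noise. Its quadratic part has no term in
[eta^3]: the products of gx with [B gy] and of gy with [B^T gx] cancel. *)
Lemma energy_seg_step eta B gx gy z (a := seg_step eta B 0 0 z) :
  energy (seg_step eta B gx gy z) =
    energy a + eta ^+ 2 * energy (gx, gy)
    + eta ^+ 4 * gram_form B (gx, gy)
    + (dot (- (2 * eta) *: (a.1 + eta *: (B *m a.2))) gx
       + dot ((2 * eta) *: (a.2 - eta *: (B^T *m a.1))) gy).
Proof.
rewrite seg_stepE -/a /energy /gram_form /= /gram /gramhat -!mulmxA.
rewrite !(dotDl, dotDr, dotNl, dotNr, dotZl, dotZr) !dot_mull ?trmxK.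
rewrite !(dotC gx) !(dotC gy) !(dotC (_ *m gx)) !(dotC (_ *m gy)).
rewrite !dot_mull ?trmxK.
by rewrite (dotC gy (B^T *m gx)) dot_mull trmxK; ring.
Qed.

(** The terms that are bilinear in x and y come with opposite signs from the two
coordinates; at third order they cancel because
[(B B^T) B = B (B^T B)]. *)
Lemma energy_seg_step0 eta B x y :
  energy (seg_step eta B 0 0 (x, y)) =
    energy (x, y) - eta ^+ 2 * gram_form B (x, y)
    + eta ^+ 4 * (dot x (sqrmx (gram B) *m x) + dot y (sqrmx (gramhat B) *m y)).
Proof.
rewrite /energy /gram_form /= !addr0 /sqrmx /gram /gramhat -!mulmxA.
rewrite !(mulmxDr, mulmxN, =^~ scalemxAr, scalerDr, scalerN).
rewrite !(dotDl, dotDr, dotNl, dotNr, dotZl, dotZr) !dot_mull ?trmxK.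
rewrite (dotC y (B^T *m x)) (dotC y (B^T *m (B *m (B^T *m x)))).
by rewrite !dot_mull !trmxK; ring.
Qed.
End energy.

(** * Measurability of matrix-valued functions *)

Section measurable_matrix.
Context {R : realType}.

Lemma measurable_entry p q (i : 'I_p) (j : 'I_q) :
  measurable_fun setT (fun A : 'M[R]_(p, q) => A i j).
Proof.
move=> _ Y mY; apply: sub_sigma_algebra; exists (i, j) => //.
by exists Y.
Qed.

Lemma measurable_mx d (T : measurableType d) p q (f : T -> 'M[R]_(p, q)) :
  (forall i j, measurable_fun setT (fun w => f w i j)) ->
  measurable_fun setT f.
Proof.
move=> mf; apply: (measurability (\bigcup_(ij in [set: 'I_p * 'I_q])
  preimage_set_system setT (fun A : 'M[R]_(p, q) => A ij.1 ij.2)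
    (@measurable _ R))) => //.
move=> _ [_ [[i j] _ [Y mY <-]] <-].
rewrite !setTI -comp_preimage -[X in measurable X]setTI.
exact: mf.
Qed.

Context d (T : measurableType d).

Lemma measurable_mx_entry p q (f : T -> 'M[R]_(p, q)) i j :
  measurable_fun setT f -> measurable_fun setT (fun w => f w i j).
Proof. by move=> mf; exact: (measurableT_comp (measurable_entry i j) mf). Qed.

Lemma measurable_mulmx p q r (f : T -> 'M[R]_(p, q)) (g : T -> 'M[R]_(q, r)) :
  measurable_fun setT f -> measurable_fun setT g ->
  measurable_fun setT (fun w => f w *m g w).
Proof.
move=> mf mg; apply: measurable_mx => i j; under eq_fun do rewrite mxE.
apply: measurable_sum => k.
by apply: measurable_funM; exact: measurable_mx_entry.
Qed.

Lemma measurable_addmx p q (f g : T -> 'M[R]_(p, q)) :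
  measurable_fun setT f -> measurable_fun setT g ->
  measurable_fun setT (fun w => f w + g w).
Proof.
move=> mf mg; apply: measurable_mx => i j; under eq_fun do rewrite mxE.
by apply: measurable_funD; exact: measurable_mx_entry.
Qed.

Lemma measurable_scalemx p q a (f : T -> 'M[R]_(p, q)) :
  measurable_fun setT f -> measurable_fun setT (fun w => a *: f w).
Proof.
move=> mf; apply: measurable_mx => i j; under eq_fun do rewrite mxE.
by apply: measurable_funM => //; exact: measurable_mx_entry.
Qed.

Lemma measurable_oppmx p q (f : T -> 'M[R]_(p, q)) :
  measurable_fun setT f -> measurable_fun setT (fun w => - f w).
Proof.
move=> mf; apply: measurable_mx => i j; under eq_fun do rewrite mxE.
by apply: measurableT_comp => //; exact: measurable_mx_entry.
Qed.

Lemma measurable_trmx p q (f : T -> 'M[R]_(p, q)) :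
  measurable_fun setT f -> measurable_fun setT (fun w => (f w)^T).
Proof.
move=> mf; apply: measurable_mx => i j; under eq_fun do rewrite mxE.
exact: measurable_mx_entry.
Qed.

Lemma measurable_dot p (f g : T -> 'cV[R]_p) :
  measurable_fun setT f -> measurable_fun setT g ->
  measurable_fun setT (fun w => dot (f w) (g w)).
Proof.
move=> mf mg; apply: measurable_mx_entry; apply: measurable_mulmx => //.
exact: measurable_trmx.
Qed.

End measurable_matrix.

Section measurable_step.
Context {R : realType} {n m : nat} d (T : measurableType d).

Lemma measurable_energy (z : T -> 'cV[R]_n * 'cV[R]_m) :
  measurable_fun setT z -> measurable_fun setT (fun w => energy (z w)).
Proof.
move=> /measurable_fun_pairP[mx my].
by apply: measurable_funD; exact: measurable_dot.
Qed.

Lemma measurable_seg_step eta (B : T -> 'M[R]_(n, m)) gx gy z :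
  measurable_fun setT B -> measurable_fun setT gx -> measurable_fun setT gy ->
  measurable_fun setT z ->
  measurable_fun setT (fun w => seg_step eta (B w) (gx w) (gy w) (z w)).
Proof.
move=> mB mgx mgy /measurable_fun_pairP[mx my].
have mBT := measurable_trmx mB.
rewrite (_ : (fun w => _) = fun w =>
  ((z w).1 - eta *:
     (B w *m ((z w).2 + eta *: ((B w)^T *m (z w).1 + gy w)) + gx w),
   (z w).2 + eta *:
     ((B w)^T *m ((z w).1 - eta *: (B w *m (z w).2 + gx w)) + gy w)));
  last by apply/funext => w; case: (z w).
by apply: measurable_fun_pair;
  do ?[exact: mx | exact: my | exact: mB | exact: mBT | exact: mgx | exact: mgy
      | apply: measurable_addmx | apply: measurable_oppmx
      | apply: measurable_scalemx | apply: measurable_mulmx].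
Qed.

Lemma measurable_gram_form (B : T -> 'M[R]_(n, m)) g h :
  measurable_fun setT B -> measurable_fun setT g -> measurable_fun setT h ->
  measurable_fun setT (fun w => gram_form (B w) (g w, h w)).
Proof.
move=> mB mg mh; rewrite /gram_form /gram /gramhat.
have mBT := measurable_trmx mB.
by apply: measurable_funD; apply: measurable_dot => //;
  apply: measurable_mulmx => //; exact: measurable_mulmx.
Qed.

End measurable_step.

(** * Independence and the theorem of Tonelli *)

Section independence.
Local Open Scope ereal_scope.
Context {R : realType}.

Lemma measure_rectangle_unique d1 d2 (T1 : measurableType d1)
    (T2 : measurableType d2) (m1 m2 : {measure set (T1 * T2) -> \bar R}) :
  m1 setT < +oo ->
  (forall A C, measurable A -> measurable C -> m1 (A `*` C) = m2 (A `*` C)) ->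
  forall D, measurable D -> m1 D = m2 D.
Proof.
move=> m1oo m12 D mD.
apply: (measure_unique [set A `*` C | A in measurable & C in measurable]
  (fun=> setT)) => //.
- exact: measurable_prod_measurableType.
- move=> _ _ [A mA [C mC <-]] [A' mA' [C' mC' <-]]; rewrite -setXI.
  by exists (A `&` A'); [exact: measurableI|exists (C `&` C');
    first exact: measurableI].
- by move=> _; exists setT => //; exists setT => //; exact: setXTT.
- by rewrite bigcup_const.
- by move=> _ [A mA [C mC <-]]; exact: m12.
Qed.

(** Y' may live on another probability space: the hypothesis says at once that X
and Y are independent and that Y has the law of Y'. *)
Lemma ge0_integral_indep d d' d1 d2 (T : measurableType d)
    (T' : measurableType d') (T1 : measurableType d1) (T2 : measurableType d2)
    (P : probability T R) (Q : probability T' R)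
    (X : {mfun T >-> T1}) (Y : {mfun T >-> T2}) (Y' : {mfun T' >-> T2})
    (f : T1 * T2 -> \bar R) :
  (forall A C, measurable A -> measurable C ->
    P (X @^-1` A `&` Y @^-1` C) = P (X @^-1` A) * Q (Y' @^-1` C)) ->
  measurable_fun setT f -> (forall u, 0 <= f u) ->
  \int[P]_w f (X w, Y w) = \int[P]_w \int[Q]_v f (X w, Y' v).
Proof.
move=> XY mf f0.
have mZ : measurable_fun setT (fun w => (X w, Y w)).
  exact: measurable_fun_pair.
pose Z : {mfun T >-> (T1 * T2)%type} :=
  HB.pack (fun w => (X w, Y w)) (isMeasurableFun.Build _ _ _ _ _ mZ).
transitivity (\int[distribution P Z]_u f u).
  by rewrite ge0_integral_distribution.
have E := @product_measure_unique _ _ _ _ R (distribution P X)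
  (distribution Q Y') (distribution P Z).
rewrite (eq_measure_integral (distribution P X \x distribution Q Y')%E).
  rewrite fubini_tonelli1 //.
  rewrite ge0_integral_distribution //.
  - apply: eq_integral => w _.
    rewrite /fubini_F /= ge0_integral_distribution //.
    exact: measurableT_comp.
  - exact: measurable_fun_fubini_tonelli_F.
  - by move=> x; exact: integral_ge0.
move=> D mD _; by rewrite -E.
Qed.
End independence.

(** * Chains driven by independent samples *)

Section chain.
Local Open Scope ereal_scope.
Context {R : realType} d dE dS (T : measurableType d) (E : measurableType dE)
  (S : measurableType dS) (P : probability T R).
Variables (Z : nat -> T -> E) (F : S * E -> S) (s0 : S) (z : nat -> T -> S).
Hypothesis mZ : forall t, measurable_fun setT (Z t).
Hypothesis mF : measurable_fun setT F.
Hypothesis z0 : forall w, z 0%N w = s0.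
Hypothesis zS : forall t w, z t.+1 w = F (z t w, Z t.+1 w).

Lemma measurable_chain t : measurable_fun setT (z t).
Proof.
elim: t => [|t IHt]; first by rewrite (_ : z 0%N = cst s0) //; apply/funext.
rewrite (_ : z t.+1 = F \o (fun w => (z t w, Z t.+1 w))); last exact/funext/zS.
by apply: measurableT_comp => //; exact: measurable_fun_pair.
Qed.

Hypothesis indepZ : mutually_independent P [set t | (1 <= t)%N] Z.

Lemma measurable_samples (J : seq nat) (A : nat -> set E) :
  (forall t, measurable (A t)) ->
  measurable (\bigcap_(t in [set` J]) (Z t @^-1` A t)).
Proof.
move=> mA; apply: bigcap_measurableType.
by move=> t _; rewrite -[X in measurable X]setTI; exact: mZ.
Qed.

(** An additional constraint on one more sample is a constraint of the same
form, which is how the induction below absorbs the next sample. *)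
Lemma samples_cons t (J : seq nat) (A : nat -> set E) C : t \notin J ->
  \bigcap_(s in [set` t :: J]) (Z s @^-1` (if s == t then C else A s)) =
  Z t @^-1` C `&` \bigcap_(s in [set` J]) (Z s @^-1` A s).
Proof.
move=> tJ; rewrite !bigcap_seq big_cons eqxx; congr (_ `&` _).
apply: eq_big_seq => s /= sJ; case: eqVneq => // st.
by rewrite -st sJ in tJ.
Qed.

Lemma sample_indep t (J : seq nat) (A : nat -> set E) C :
    uniq (t :: J) -> all (fun s => 0 < s)%N (t :: J) ->
    (forall s, measurable (A s)) -> measurable C ->
  let G := \bigcap_(s in [set` J]) (Z s @^-1` A s) in
  P (Z t @^-1` C `&` G) = P (Z t @^-1` C) * P G.
Proof.
move=> uJ /allP J0 mA mC G; rewrite /G -samples_cons; last by case/andP: uJ.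
rewrite indepZ //; last by move=> s; case: ifP.
rewrite indepZ //=.
- rewrite big_cons eqxx; congr (_ * _); apply: eq_big_seq => s sJ.
  by case: eqVneq => // st; move: uJ; rewrite /= -st sJ.
- by case/andP: uJ.
- by move=> s sJ; apply: J0; rewrite inE [s \in J]sJ orbT.
Qed.

(** The state z_t is independent of any finite family of later samples. In the
induction step, let G be an event on the samples after t+1. As functions of D,
[P ((z_t, Z_(t+1)) \in D, G)] and [P ((z_t, Z_(t+1)) \in D) * P G] are
finite measures that agree on rectangles, by the induction hypothesis applied
to the samples of G together with Z_(t+1). Hence they agree on the preimage
under F of any measurable set. *)
Lemma chain_indep_future t (J : seq nat) (A : nat -> set E) C :
    uniq J -> all (fun s => t < s)%N J -> (forall s, measurable (A s)) ->
    measurable C ->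
  let G := \bigcap_(s in [set` J]) (Z s @^-1` A s) in
  P (z t @^-1` C `&` G) = P (z t @^-1` C) * P G.
Proof.
elim: t J A C => [|t IHt] J A C uJ tJ mA mC G.
  have [Cs0|Cs0] := pselect (C s0).
    rewrite (_ : z 0%N @^-1` C = setT) ?setTI ?probability_setT ?mul1e //.
    by apply/seteqP; split => // w _; rewrite /= z0.
  rewrite (_ : z 0%N @^-1` C = set0) ?set0I ?measure0 ?mul0e //.
  by apply/seteqP; split => // w; rewrite /= z0.
have mG : measurable G by exact: measurable_samples.
have mZt : measurable_fun setT (fun w => (z t w, Z t.+1 w)).
  by apply: measurable_fun_pair => //; exact: measurable_chain.
pose zZ w := (z t w, Z t.+1 w).
have pG0 : (0 <= fine (P G))%R by rewrite fine_ge0.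
pose k := NngNum pG0.
have kE : k%:num%:E = P G by rewrite fineK // fin_num_measure.
have zE : zZ @^-1` (F @^-1` C) = z t.+1 @^-1` C.
  by apply/seteqP; split => w /=; rewrite zS.
suff : pushforward (mrestr P mG) zZ (F @^-1` C) =
    mscale k (pushforward P zZ) (F @^-1` C).
  move=> /(_ mZt); rewrite /pushforward /mscale /mrestr zE kE => ->.
  by rewrite muleC; congr (P _ * _).
move=> mzZ; apply: measure_rectangle_unique => /=.
- rewrite /pushforward /mrestr preimage_setT setTI.
  exact: le_lt_trans (probability_le1 P mG) (ltry _).
- move=> A' C' mA' mC'; rewrite /mscale kE.
  change (P (zZ @^-1` (A' `*` C') `&` G) = P G * P (zZ @^-1` (A' `*` C'))).
  rewrite (_ : zZ @^-1` (A' `*` C') = z t @^-1` A' `&` Z t.+1 @^-1` C') //.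
  rewrite -[in LHS]setIA.
  have tJ' : t.+1 \notin J by apply/negP => /(allP tJ); rewrite ltnn.
  have J't : all (fun s => t < s)%N (t.+1 :: J).
    by rewrite /= ltnSn; apply: sub_all tJ => s /ltnW.
  have uJ' : uniq (t.+1 :: J) by rewrite /= tJ'.
  have := IHt (t.+1 :: J) (fun s => if s == t.+1 then C' else A s) A' uJ' J't.
  rewrite samples_cons //= => ->; [|by move=> s; case: ifP|by []].
  have := IHt [:: t.+1] (fun s => if s == t.+1 then C' else A s) A'.
  rewrite samples_cons //= ltnSn bigcap_seq big_nil setIT => -> //; last first.
    by move=> s; case: ifP.
  rewrite sample_indep //; last first.
    by apply: sub_all J't => s; exact: leq_ltn_trans.
  by rewrite muleA muleC.
- rewrite -[X in measurable X]setTI; exact: mF.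
Qed.

Lemma chain_indep_next t A C : measurable A -> measurable C ->
  P (z t @^-1` A `&` Z t.+1 @^-1` C) = P (z t @^-1` A) * P (Z t.+1 @^-1` C).
Proof.
move=> mA mC; have := @chain_indep_future t [:: t.+1] (fun=> C) A.
by rewrite /= ltnSn set_cons1 bigcap_set1 => ->.
Qed.

End chain.

(** * Means of real and matrix-valued random variables *)

(** Integrability and the value of the integral are carried together, so that
means of linear combinations are computed without separate integrability
arguments. *)
Definition has_mean {R : realType} d (T : measurableType d)
    (P : probability T R) (f : T -> R) (a : R) : Prop :=
  P.-integrable setT (EFin \o f) /\ (\int[P]_w (f w)%:E = a%:E)%E.

Section has_mean.
Context {R : realType} d (T : measurableType d) (P : probability T R).

Lemma eq_has_mean (f g : T -> R) a : f =1 g -> has_mean P f a -> has_mean P g a.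
Proof. by move=> /funext ->. Qed.

Lemma has_mean_cst a : has_mean P (fun=> a) a.
Proof.
split; first exact: (finite_measure_integrable_cst P a measurableT).
transitivity (a%:E * P setT)%E; first exact: (integral_cst P measurableT a%:E).
by rewrite probability_setT mule1.
Qed.

Lemma has_meanD f g a b : has_mean P f a -> has_mean P g b ->
  has_mean P (fun w => f w + g w) (a + b).
Proof.
move=> [fi fa] [gi gb]; split; first exact: (integrableD measurableT fi gi).
have := @integralD_EFin _ _ _ P setT measurableT f g fi gi.
by rewrite /= fa gb EFinD => <-; apply: eq_integral.
Qed.

Lemma has_meanZ k f a : has_mean P f a -> has_mean P (fun w => k * f w) (k * a).
Proof.
move=> [fi fa]; split; first exact: (integrableZl measurableT k fi).
by have := integralZl measurableT fi k; rewrite /= fa.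
Qed.

Lemma has_mean_sum (I : Type) (s : seq I) (f : I -> T -> R) (a : I -> R) :
  (forall i, has_mean P (f i) (a i)) ->
  has_mean P (fun w => \sum_(i <- s) f i w) (\sum_(i <- s) a i).
Proof.
move=> fa; elim: s => [|i s IHs].
  by rewrite big_nil; apply: eq_has_mean (has_mean_cst 0) => w; rewrite big_nil.
rewrite big_cons; apply: eq_has_mean (has_meanD (fa i) IHs) => w.
by rewrite big_cons.
Qed.

Lemma has_mean_fine f : P.-integrable setT (EFin \o f) ->
  has_mean P f (fine (\int[P]_w (f w)%:E)%E).
Proof.
by move=> fi; split=> //; rewrite fineK //; exact: integrable_fin_num.
Qed.

Lemma has_mean_measurable f a : has_mean P f a -> measurable_fun setT f.
Proof. by case=> /integrableP[/measurable_EFinP]. Qed.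

Lemma has_mean_le f a g b : has_mean P f a -> has_mean P g b ->
  (forall w, f w <= g w) -> a <= b.
Proof.
move=> [fi fa] [gi gb] fg; rewrite -lee_fin -fa -gb.
by apply: le_integral => // w _; rewrite lee_fin.
Qed.

Lemma has_mean_entry p q (X : T -> 'M[R]_(p, q)) i j : mx_integrable P X ->
  has_mean P (fun w => X w i j) (mx_expect P X i j).
Proof.
move=> Xi; rewrite mxE expectation.unlock.
exact: (has_mean_fine (Xi i j)).
Qed.

Lemma has_mean_bilinear p q (X : T -> 'M[R]_(p, q)) u v : mx_integrable P X ->
  has_mean P (fun w => dot u (X w *m v)) (dot u (mx_expect P X *m v)).
Proof.
move=> Xi.
have E (A : 'M[R]_(p, q)) :
    dot u (A *m v) = \sum_i u i 0 * \sum_j v j 0 * A i j.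
  rewrite dotE; apply: eq_bigr => i _; congr (_ * _); rewrite mxE.
  by apply: eq_bigr => j _; rewrite mulrC.
rewrite E; apply: (eq_has_mean (fun w => esym (E (X w)))).
apply: has_mean_sum => i; apply: has_meanZ; apply: has_mean_sum => j.
exact/has_meanZ/has_mean_entry.
Qed.

Lemma has_mean_dot p (X : T -> 'cV[R]_p) u : mx_integrable P X ->
  has_mean P (fun w => dot u (X w)) (dot u (mx_expect P X)).
Proof.
move=> Xi; rewrite -[mx_expect P X]mulmx1.
by apply: eq_has_mean (has_mean_bilinear u 1%:M Xi) => w; rewrite mulmx1.
Qed.

Lemma ge0_integral_has_mean (f : T -> R) b :
  measurable_fun setT f -> (forall w, 0 <= f w) ->
  (\int[P]_w (f w)%:E <= b%:E)%E -> exists2 a, has_mean P f a & a <= b.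
Proof.
move=> mf f0 fb.
have fi : P.-integrable setT (EFin \o f).
  apply/integrableP; split; first exact/measurable_EFinP.
  under eq_integral do rewrite /= ger0_norm //.
  exact: le_lt_trans fb (ltry _).
exists (fine (\int[P]_w (f w)%:E)%E); first exact: has_mean_fine.
by rewrite -lee_fin fineK //; exact: integrable_fin_num.
Qed.

Lemma has_mean_dominated (f g : T -> R) a : measurable_fun setT f ->
  (forall w, `|f w| <= g w) -> has_mean P g a -> exists b, has_mean P f b.
Proof.
move=> mf fg [gi _]; eexists; apply: has_mean_fine.
apply: le_integrable gi => //; first exact/measurable_EFinP.
move=> w _ /=; rewrite lee_fin; apply: le_trans (fg w) _; exact: ler_norm.
Qed.

End has_mean.

(** * Random symmetric matrices and their squares *)

Section mean_square.
Context {R : realType} d (T : measurableType d) (P : probability T R) (p : nat).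
Variable X : T -> 'M[R]_p.
Hypothesis symX : forall w, (X w)^T = X w.
Hypothesis X_int : mx_integrable P X.
Hypothesis X2_int : mx_integrable P (fun w => sqrmx (X w)).
Let M := mx_expect P X.
Let M2 := mx_expect P (fun w => sqrmx (X w)).
Hypothesis M_gt0 : 0 < lambda_min M.
Let rho := lambda_max (invsqrtmx M *m M2 *m invsqrtmx M).

Lemma mx_expect_sym (Y : T -> 'M[R]_p) :
  (forall w, (Y w)^T = Y w) -> (mx_expect P Y)^T = mx_expect P Y.
Proof.
move=> symY; apply/matrixP => i j; rewrite !mxE; congr (fine 'E_P[_])%E.
by apply/funext => w; rewrite -{1}symY mxE.
Qed.

Let symM : M^T = M. Proof. exact: mx_expect_sym. Qed.

Let sqr_le u : dot u (M2 *m u) <= rho * dot u (M *m u).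
Proof.
apply: rayleigh_quotient_le => //; apply: mx_expect_sym => w.
by rewrite /sqrmx trmx_mul !symX.
Qed.

(** The variance of [X u] is nonnegative; the proof integrates the pointwise
inequality [2 (X u).(M u) - |M u|^2 <= |X u|^2]. *)
Lemma sqr_mean_le u : dot (M *m u) (M *m u) <= dot u (M2 *m u).
Proof.
have h1 := has_meanD (has_meanZ 2 (has_mean_bilinear (M *m u) u X_int))
  (has_mean_cst P (- dot (M *m u) (M *m u))).
have := has_mean_le h1 (has_mean_bilinear u u X2_int).
rewrite -/M -/M2; set a := dot _ _ => h.
suff : 2 * a - a <= dot u (M2 *m u) by lra.
apply: h => w; rewrite /sqrmx -mulmxA -{2}symX -dot_mull.
have := dot_ge0 (X w *m u - M *m u).
rewrite dotDl !dotDr !dotNl !dotNr opprK (dotC (X w *m u) (M *m u)) /a; lra.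
Qed.

(** From [|M u|^2 <= rho u.Mu] and [0 <= |rho u - M u|^2] one gets
[rho u.Mu <= rho^2 |u|^2]. That rho is positive also follows from the first
inequality, as [u.Mu] is positive for nonzero u. *)
Lemma mean_le_rho u : dot u (M *m u) <= rho * dot u u.
Proof.
have [->|u0] := eqVneq u 0; first by rewrite mulmx0 !dot0r mulr0.
have uu_gt0 : 0 < dot u u.
  by rewrite lt_neqAle dot_ge0 andbT eq_sym; apply: contra_neq u0 => /dot_eq0.
have Mu_gt0 : 0 < dot u (M *m u).
  by apply: lt_le_trans (lambda_min_le u symM); exact: mulr_gt0.
have Mu_le : dot (M *m u) (M *m u) <= rho * dot u (M *m u).
  exact: le_trans (sqr_mean_le u) (sqr_le u).
have rho_gt0 : 0 < rho.
  rewrite -(pmulr_lgt0 _ Mu_gt0); apply: lt_le_trans Mu_le.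
  rewrite lt_neqAle dot_ge0 andbT eq_sym.
  apply: contraTneq Mu_gt0 => /dot_eq0 ->.
  by rewrite dot0r ltxx.
have := dot_ge0 (rho *: u - M *m u).
rewrite dotDl !dotDr !dotNl !dotNr !dotZl !dotZr opprK (dotC (M *m u) u) => h.
by rewrite -(ler_pM2l rho_gt0); lra.
Qed.

(** Compare both bounds of [u.Mu] at a unit vector u. There is one, since the
spectrum of the empty matrix is empty and its infimum would be 0. *)
Lemma lambda_min_le_rho : lambda_min M <= rho.
Proof.
have p_gt0 : (0 < p)%N.
  rewrite lt0n; apply/eqP => p0; move: M_gt0.
  by move: M; rewrite p0 => M'; rewrite lambda_min0 ltxx.
pose u : 'cV[R]_p := delta_mx (Ordinal p_gt0) 0.
have uu : dot u u = 1 by rewrite /dot trmx_delta mul_delta_mx mxE !eqxx.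
have := le_trans (lambda_min_le u symM) (mean_le_rho u).
by rewrite uu !mulr1.
Qed.

End mean_square.

(** * Mean energy after one step *)

Section step.
Context {R : realType} {n m : nat} d (T : measurableType d)
  (P : probability T R).
Variables (B : {RV P >-> 'M[R]_(n, m)}) (gx : {RV P >-> 'cV[R]_n})
  (gy : {RV P >-> 'cV[R]_m}) (sB sB2 sg : R).
Hypothesis noiseB : noise_B P B sB sB2.
Hypothesis noiseg : noise_g P B gx gy sg.

Let M := meanM P B.
Let Mh := meanMhat P B.
Let lam := lambda_minM P B.
Let rho := Num.max (rho1 P B) (rho2 P B).

Let G w := energy (gx w, gy w).

Lemma noise_energy_mean : exists2 s, has_mean P G s & s <= sg ^+ 2.
Proof.
apply: ge0_integral_has_mean.
- by apply: measurable_energy; exact: measurable_fun_pair.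
- by move=> w; exact: energy_ge0.
have := var_g noiseg; rewrite expectation.unlock.
by under eq_integral do rewrite !enorm2E.
Qed.

(** A square-integrable vector is integrable, by [2 |t| <= 1 + t^2]. *)
Lemma mx_integrable_noise p (g : {mfun T >-> 'cV[R]_p}) :
  (forall w, dot (g w) (g w) <= G w) -> mx_integrable P g.
Proof.
move=> gG i j; have [s Gs _] := noise_energy_mean.
rewrite ord1.
have [|||b []//] := @has_mean_dominated _ _ _ P (fun w => g w i 0)
    (fun w => 1 + G w) (1 + s).
- exact: measurable_mx_entry.
- move=> w; have := le_trans (entry_sqr_le (g w) i) (gG w).
  have := sqr_ge0 (`|g w i 0| - 1); rewrite -(real_normK (num_real (g w i 0))).
  have := normr_ge0 (g w i 0); nra.
- exact: has_meanD (has_mean_cst P 1) Gs.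
Qed.

Lemma has_mean_noise (u : 'cV[R]_n) (v : 'cV[R]_m) :
  has_mean P (fun w => dot u (gx w) + dot v (gy w)) 0.
Proof.
rewrite -[X in has_mean _ _ X](addr0 0); apply: has_meanD.
  have <- : dot u (mx_expect P gx) = 0 by rewrite (mean_gx noiseg) dot0r.
  apply: has_mean_dot; apply: mx_integrable_noise => w.
  by rewrite lerDl dot_ge0.
have <- : dot v (mx_expect P gy) = 0 by rewrite (mean_gy noiseg) dot0r.
apply: has_mean_dot; apply: mx_integrable_noise => w.
by rewrite lerDr dot_ge0.
Qed.

Lemma has_mean_gram_form_noise b :
  exists s, has_mean P (fun w => gram_form b (gx w, gy w)) s.
Proof.
have [s Gs _] := noise_energy_mean.
pose c := `|lambda_max (gram b)| + `|lambda_max (gramhat b)|.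
apply: (has_mean_dominated _ _ (has_meanZ c Gs)).
  exact: measurable_gram_form.
move=> w; rewrite ger0_norm ?gram_form_ge0 // /gram_form /G /energy /=.
rewrite mulrDr lerD //.
  apply: le_trans (lambda_max_ge _ (gram_sym b)) _.
  rewrite ler_wpM2r ?dot_ge0 //; apply: le_trans (ler_norm _) _.
  by rewrite lerDl.
apply: le_trans (lambda_max_ge _ (gramhat_sym b)) _.
rewrite ler_wpM2r ?dot_ge0 //; apply: le_trans (ler_norm _) _.
by rewrite lerDr.
Qed.

(** The mean over the noise alone, for a fixed matrix b: the linear part drops
out. *)
Lemma energy_step_noise_mean eta b z s : has_mean P G s ->
  (\int[P]_w (energy (seg_step eta b (gx w) (gy w) z))%:E =
   (energy (seg_step eta b 0 0 z) + eta ^+ 2 * s)%:E +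
   (eta ^+ 4)%:E * \int[P]_w (gram_form b (gx w, gy w))%:E)%E.
Proof.
move=> Gs; have [h Hh] := has_mean_gram_form_noise b.
rewrite Hh.2 -EFinM -EFinD.
set a := seg_step eta b 0 0 z.
have := has_meanD (has_meanD (has_meanD (has_mean_cst P (energy a))
  (has_meanZ (eta ^+ 2) Gs)) (has_meanZ (eta ^+ 4) Hh))
  (has_mean_noise (- (2 * eta) *: (a.1 + eta *: (b *m a.2)))
     ((2 * eta) *: (a.2 - eta *: (b^T *m a.1)))).
rewrite addr0 => -[_ <-]; apply: eq_integral => w _.
by rewrite energy_seg_step.
Qed.

Let lam_gt0 : 0 < lam. Proof. exact: lambda_minM_gt0 noiseB. Qed.

Let M_gt0 : 0 < lambda_min M.
Proof. by have := lam_gt0; rewrite lt_min => /andP[]. Qed.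

Let Mh_gt0 : 0 < lambda_min Mh.
Proof. by have := lam_gt0; rewrite lt_min => /andP[]. Qed.

Let M_sym : M^T = M.
Proof. by apply: mx_expect_sym => w; exact: gram_sym. Qed.

Let Mh_sym : Mh^T = Mh.
Proof. by apply: mx_expect_sym => w; exact: gramhat_sym. Qed.

Lemma lambda_minM_le_rho : lam <= rho.
Proof.
rewrite le_max ge_min; apply/orP; left; apply/orP; left.
apply: lambda_min_le_rho => //.
- by move=> w; exact: gram_sym.
- exact: integrable_M noiseB.
- exact: integrable_sqrM noiseB.
Qed.

Lemma has_mean_gram_form g1 g2 :
  has_mean P (fun w => gram_form (B w) (g1, g2))
    (dot g1 (M *m g1) + dot g2 (Mh *m g2)).
Proof.
apply: has_meanD.
  exact: (has_mean_bilinear _ _ (integrable_M noiseB)).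
exact: (has_mean_bilinear _ _ (integrable_Mhat noiseB)).
Qed.

Lemma mean_gram_form_le g1 g2 :
  dot g1 (M *m g1) + dot g2 (Mh *m g2) <= rho * energy (g1, g2).
Proof.
rewrite /energy mulrDr lerD //=.
- apply: le_trans (mean_le_rho _ (integrable_M noiseB) (integrable_sqrM noiseB)
    M_gt0 _) _.
    by move=> w; exact: gram_sym.
  by rewrite ler_wpM2r ?dot_ge0 // le_max lexx.
- apply: le_trans (mean_le_rho _ (integrable_Mhat noiseB)
    (integrable_sqrMhat noiseB) Mh_gt0 _) _.
    by move=> w; exact: gramhat_sym.
  by rewrite ler_wpM2r ?dot_ge0 // le_max lexx orbT.
Qed.

Lemma mean_gram_form_ge g1 g2 :
  lam * energy (g1, g2) <= dot g1 (M *m g1) + dot g2 (Mh *m g2).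
Proof.
rewrite /energy mulrDr lerD //=.
  apply: le_trans (lambda_min_le _ M_sym).
  by rewrite ler_wpM2r ?dot_ge0 // ge_min lexx.
apply: le_trans (lambda_min_le _ Mh_sym).
by rewrite ler_wpM2r ?dot_ge0 // ge_min lexx orbT.
Qed.

(** Contraction of the noise-free step: [eta^4 rho] times the mean of the Gram
form is at most half of the first-order decrease. *)
Lemma energy_step0_mean eta z : eta ^+ 2 * rho <= 2^-1 ->
  exists2 s, has_mean P (fun w => energy (seg_step eta (B w) 0 0 z)) s &
    s <= (1 - eta ^+ 2 / 2 * lam) * energy z.
Proof.
case: z => x y eta_rho.
pose Q := mx_expect P (fun w => sqrmx (gram (B w))).
pose Qh := mx_expect P (fun w => sqrmx (gramhat (B w))).
exists (energy (x, y) + - eta ^+ 2 * (dot x (M *m x) + dot y (Mh *m y))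
  + eta ^+ 4 * (dot x (Q *m x) + dot y (Qh *m y))).
  have hQ := has_meanD (has_mean_bilinear x x (integrable_sqrM noiseB))
    (has_mean_bilinear y y (integrable_sqrMhat noiseB)).
  apply: eq_has_mean (has_meanD (has_meanD (has_mean_cst P (energy (x, y)))
    (has_meanZ (- eta ^+ 2) (has_mean_gram_form x y)))
    (has_meanZ (eta ^+ 4) hQ)) => w.
  by rewrite energy_seg_step0 mulNr.
have := mean_gram_form_ge x y; set t := _ + dot y _ => lam_t.
have Qt : dot x (Q *m x) + dot y (Qh *m y) <= rho * t.
  have Mx0 : 0 <= dot x (M *m x).
    apply: le_trans (lambda_min_le _ M_sym).
    by rewrite mulr_ge0 ?dot_ge0 // ltW.
  have My0 : 0 <= dot y (Mh *m y).
    apply: le_trans (lambda_min_le _ Mh_sym).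
    by rewrite mulr_ge0 ?dot_ge0 // ltW.
  rewrite /t mulrDr lerD //.
    apply: le_trans (rayleigh_quotient_le _ M_sym _ M_gt0) _.
      by apply: mx_expect_sym => w; rewrite /sqrmx trmx_mul !gram_sym.
    by rewrite ler_wpM2r // le_max lexx.
  apply: le_trans (rayleigh_quotient_le _ Mh_sym _ Mh_gt0) _.
    by apply: mx_expect_sym => w; rewrite /sqrmx trmx_mul !gramhat_sym.
  by rewrite ler_wpM2r // le_max lexx orbT.
have t_ge0 : 0 <= t.
  by apply: le_trans lam_t; rewrite mulr_ge0 ?energy_ge0 // ltW // lam_gt0.
have e2 : 0 <= eta ^+ 2 by exact: sqr_ge0.
(* The claim is the sum of h1, h2 and half of h3. *)
have h1 := ler_wpM2l (sqr_ge0 (eta ^+ 2)) Qt.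
have h2 := ler_wpM2l (mulr_ge0 e2 t_ge0) eta_rho.
have h3 := ler_wpM2l e2 lam_t.
rewrite -exprM in h1; move: h1 h2 h3.
set q := dot x _ + _; set e := energy _; set f := eta ^+ 2 in e2 *.
have -> : eta ^+ (2 * 2) = f ^+ 2 by rewrite -exprM.
lra.
Qed.

(** By independence, the mean is an integral over the noise, then over B. In the
remaining double integral of the Gram form the order is exchanged, because the
bound [mean_gram_form_le] holds after averaging over B, for a fixed noise. *)
Lemma energy_step_mean_le eta z : eta ^+ 2 * rho <= 2^-1 ->
  (\int[P]_w (energy (seg_step eta (B w) (gx w) (gy w) z))%:E <=
   ((1 - eta ^+ 2 / 2 * lam) * energy z + 3 / 2 * eta ^+ 2 * sg ^+ 2)%:E)%E.
Proof.
move=> eta_rho; have [s Gs s_le] := noise_energy_mean.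
have [u Uu u_le] := energy_step0_mean z eta_rho.
pose g : {mfun T >-> ('cV[R]_n * 'cV[R]_m)%type} :=
  HB.pack (fun w => (gx w, gy w)) (isMeasurableFun.Build _ _ _ _ _
    (measurable_fun_pair (measurable_funP gx) (measurable_funP gy))).
pose f (v : 'M[R]_(n, m) * ('cV[R]_n * 'cV[R]_m)) :=
  (energy (seg_step eta v.1 v.2.1 v.2.2 z))%:E.
have mf : measurable_fun setT f.
  apply/measurable_EFinP; apply: measurable_energy.
  apply: measurable_seg_step => //; exact: measurableT_comp.
have := @ge0_integral_indep _ _ _ _ _ T T _ _ P P B g g f (indep_B_g noiseg) mf
  (fun v => energy_ge0 _).
rewrite /f /= => ->.
under eq_integral do rewrite (energy_step_noise_mean _ _ _ Gs).
pose h (ww : T * T) := (gram_form (B ww.1) (gx ww.2, gy ww.2))%:E.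
have mh : measurable_fun setT h.
  apply/measurable_EFinP; apply: measurable_gram_form;
    exact: measurableT_comp.
have h0 ww : (0 <= h ww)%E by rewrite lee_fin gram_form_ge0.
have s_ge0 : 0 <= s.
  by apply: (has_mean_le (has_mean_cst P 0) Gs) => w; exact: energy_ge0.
have mF : measurable_fun setT (fun w => \int[P]_v h (w, v))%E.
  exact: measurable_fun_fubini_tonelli_F.
have mG' : measurable_fun setT (fun v => \int[P]_w h (w, v))%E.
  exact: measurable_fun_fubini_tonelli_G.
have Hu := has_meanD Uu (has_mean_cst P (eta ^+ 2 * s)).
have eta4_ge0 : 0 <= eta ^+ 4 by rewrite (exprM _ 2 2) sqr_ge0.
have hF0 w : (0 <= \int[P]_v h (w, v))%E by exact: integral_ge0.
rewrite ge0_integralD //=; first last.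
- exact: measurable_funeM.
- by move=> w _; rewrite mule_ge0 // ?lee_fin // hF0.
- by apply/measurable_EFinP; exact: has_mean_measurable Hu.
- by move=> w _; rewrite lee_fin addr_ge0 ?energy_ge0 // mulr_ge0 ?sqr_ge0.
rewrite Hu.2 ge0_integralZl_EFin //; last by move=> w _; exact: hF0.
have hle : (\int[P]_w \int[P]_v h (w, v) <= (rho * s)%:E)%E.
  rewrite fubini_tonelli // -(has_meanZ rho Gs).2; apply: ge0_le_integral => //.
  - by move=> v _; exact: integral_ge0.
  - by apply/measurable_EFinP; exact: has_mean_measurable (has_meanZ rho Gs).
  - move=> v _; have := (has_mean_gram_form (gx v) (gy v)).2.
    by rewrite /h /= => ->; rewrite lee_fin; exact: mean_gram_form_le.
have := lee_wpmul2l (_ : (0 <= (eta ^+ 4)%:E)%E) hle.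
rewrite lee_fin => /(_ eta4_ge0) h4.
apply: le_trans (leeD2l _ h4) _.
rewrite -EFinM -EFinD lee_fin.
have e2 : 0 <= eta ^+ 2 by exact: sqr_ge0.
have h1 := ler_wpM2l (mulr_ge0 e2 s_ge0) eta_rho.
have h2 := ler_wpM2l e2 s_le.
rewrite (exprM eta 2 2); move: u_le h1 h2; move: (eta ^+ 2) => e; nra.
Qed.
End step.

(** * Iteration of the drift inequality *)

Section recursion.
Context {R : realType} d0 d dE dS (T0 : measurableType d0)
  (T : measurableType d) (E : measurableType dE) (S : measurableType dS).
Variables (P0 : probability T0 R) (P : probability T R).
Variables (xi : T0 -> E) (Z : nat -> T -> E) (F : S * E -> S) (s0 : S).
Variables (z : nat -> T -> S) (V : S -> R) (q b c : R).
Hypothesis mxi : measurable_fun setT xi.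
Hypothesis mZ : forall t, measurable_fun setT (Z t).
Hypothesis mF : measurable_fun setT F.
Hypothesis mV : measurable_fun setT V.
Hypothesis V_ge0 : forall s, 0 <= V s.
Hypothesis z0 : forall w, z 0%N w = s0.
Hypothesis zS : forall t w, z t.+1 w = F (z t w, Z t.+1 w).
Hypothesis iidZ : iid_copies P0 P xi [set t | (1 <= t)%N] Z.
Hypothesis q_ge0 : 0 <= q.
Hypothesis b_ge0 : 0 <= b.
Hypothesis drift :
  forall s, (\int[P0]_v (V (F (s, xi v)))%:E <= (q * V s + b)%:E)%E.

(** The next sample is independent of the current state and has the law of xi,
so that the drift inequality can be integrated against the law of the state. *)
Lemma chain_next_le t (e : R) : (\int[P]_w (V (z t w))%:E <= e%:E)%E ->
  (\int[P]_w (V (z t.+1 w))%:E <= (q * e + b)%:E)%E.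
Proof.
move=> Ve; have mz := measurable_chain mZ mF z0 zS t.
pose zt : {mfun T >-> S} := HB.pack (z t) (isMeasurableFun.Build _ _ _ _ _ mz).
pose Zt : {mfun T >-> E} :=
  HB.pack (Z t.+1) (isMeasurableFun.Build _ _ _ _ _ (mZ t.+1)).
pose xi' : {mfun T0 >-> E} := HB.pack xi (isMeasurableFun.Build _ _ _ _ _ mxi).
pose f (u : S * E) := (V (F u))%:E.
have mf : measurable_fun setT f.
  by apply/measurable_EFinP; exact: measurableT_comp.
have f_ge0 u : (0 <= f u)%E by rewrite lee_fin.
have indep A C : measurable A -> measurable C ->
    (P (zt @^-1` A `&` Zt @^-1` C) = P (zt @^-1` A) * P0 (xi' @^-1` C))%E.
  move=> mA mC; rewrite -(iidZ.2 t.+1) //.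
  exact: (chain_indep_next mZ mF z0 zS iidZ.1).
have -> : (\int[P]_w (V (z t.+1 w))%:E = \int[P]_w f (zt w, Zt w))%E.
  by apply: eq_integral => w _; rewrite zS.
rewrite (ge0_integral_indep indep mf f_ge0).
have mqV : measurable_fun setT (fun w => (q * V (z t w))%:E).
  by apply/measurable_EFinP/measurable_funM => //; exact: measurableT_comp.
apply: (@le_trans _ _ (\int[P]_w ((q * V (z t w))%:E + b%:E))%E).
  apply: ge0_le_integral => //.
  - by move=> w _; exact: integral_ge0.
  - have mFf := @measurable_fun_fubini_tonelli_F _ _ _ _ R
      (distribution P0 xi') f mf f_ge0.
    rewrite (_ : (fun w => _) = fubini_F (distribution P0 xi') f \o zt).
      exact: measurableT_comp.
    apply/funext => w; rewrite /fubini_F /= ge0_integral_distribution //.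
    exact: measurableT_comp.
  - by apply: emeasurable_funD.
  - by move=> w _; exact: drift.
rewrite ge0_integralD //; first last.
- by move=> w _; rewrite lee_fin mulr_ge0.
under eq_integral do rewrite EFinM.
rewrite ge0_integralZl_EFin //; first last.
- by apply/measurable_EFinP; exact: measurableT_comp.
- by move=> w _; rewrite lee_fin.
have -> : (\int[P]_w b%:E = b%:E)%E := (has_mean_cst P b).2.
by rewrite EFinD EFinM leeD2r // lee_wpmul2l.
Qed.

(** The number c is the fixed point of the affine map [e |-> q e + b]. *)
Lemma chain_mean_le t : b = (1 - q) * c -> 0 <= c ->
  (\int[P]_w (V (z t w))%:E <= (q ^+ t * V s0 + c)%:E)%E.
Proof.
move=> bc c_ge0; elim: t => [|t IHt].
  under eq_integral do rewrite z0.
  by rewrite (has_mean_cst P (V s0)).2 lee_fin expr0 mul1r lerDl.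
apply: le_trans (chain_next_le IHt) _; rewrite lee_fin bc exprS; lra.
Qed.

End recursion.

Theorem theoremA1 (R : realType) (n m : nat)
  (dxi : measure_display) (Xi : measurableType dxi) (Pxi : probability Xi R)
  (Bxi : {RV Pxi >-> 'M[R]_(n, m)})
  (gxxi : {RV Pxi >-> 'cV[R]_n}) (gyxi : {RV Pxi >-> 'cV[R]_m})
  (d : measure_display) (Omega : measurableType d) (P : probability Omega R)
  (B : nat -> {RV P >-> 'M[R]_(n, m)})
  (gx : nat -> {RV P >-> 'cV[R]_n}) (gy : nat -> {RV P >-> 'cV[R]_m})
  (x0 : 'cV[R]_n) (y0 : 'cV[R]_m) (sB sB2 sg : R)
  (iid : iid_copies Pxi P (fun w => (Bxi w, gxxi w, gyxi w))
           [set t | (1 <= t)%N] (fun t w => (B t w, gx t w, gy t w)))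
  (A1 : noise_B Pxi Bxi sB sB2)
  (A2 : noise_g Pxi Bxi gxxi gyxi sg) :
  let etaM := eta_max Pxi Bxi in
  let lam := lambda_minM Pxi Bxi in
  let z := seg (etaM / Num.sqrt 2) B gx gy x0 y0 in
  forall K : nat, (1 <= K)%N ->
    ('E_P[fun w => (enorm (z K w).1 ^+ 2 + enorm (z K w).2 ^+ 2)%R]
      <= (expR (- (etaM ^+ 2 / 4 * lam * K%:R))
            * (enorm x0 ^+ 2 + enorm y0 ^+ 2)
          + 3 * sg ^+ 2 / lam)%R%:E)%E.
Proof.
move=> etaM lam; set eta := etaM / Num.sqrt 2 => z K _.
pose rho := Num.max (rho1 Pxi Bxi) (rho2 Pxi Bxi).
have lam_gt0 : 0 < lam := lambda_minM_gt0 A1.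
have lam_rho : lam <= rho := lambda_minM_le_rho A1.
have rho_gt0 : 0 < rho := lt_le_trans lam_gt0 lam_rho.
have etaM2 : etaM ^+ 2 = rho^-1.
  by rewrite /etaM /eta_max -/rho mul1r exprVn sqr_sqrtr // ltW.
have eta2 : eta ^+ 2 = rho^-1 / 2.
  by rewrite /eta expr_div_n etaM2 sqr_sqrtr.
have eta_rho : eta ^+ 2 * rho <= 2^-1.
  by rewrite eta2 mulrAC mulVf ?mul1r // gt_eqF.
pose a := etaM ^+ 2 / 4 * lam.
(* The contraction factor must be nonnegative for the bound to be iterated. *)
have a_le1 : a <= 1.
  have : lam / rho <= 1 by rewrite ler_pdivrMr // mul1r.
  rewrite /a etaM2 mulrAC (mulrC rho^-1).
  by move: (lam / rho) => r; lra.
have c_ge0 : 0 <= 3 * sg ^+ 2 / lam.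
  by apply: divr_ge0; [apply: mulr_ge0 => //; exact: sqr_ge0|exact: ltW].
pose F (u : ('cV[R]_n * 'cV[R]_m) * ('M[R]_(n, m) * 'cV[R]_n * 'cV[R]_m)) :=
  seg_step eta u.2.1.1 u.2.1.2 u.2.2 u.1.
have mF : measurable_fun setT F.
  apply: measurable_seg_step => //.
  - do 2 apply: (measurableT_comp measurable_fst) => //.
  - by apply: (measurableT_comp measurable_snd); exact: measurableT_comp.
  - exact: measurableT_comp.
have mtriple d' (T : measurableType d') (Q : probability T R)
    (b : {RV Q >-> 'M[R]_(n, m)}) (g : {RV Q >-> 'cV[R]_n})
    (h : {RV Q >-> 'cV[R]_m}) :
    measurable_fun setT (fun w => (b w, g w, h w)).
  by do 2 apply: measurable_fun_pair => //.
have drift u : (\int[Pxi]_v (energy (F (u, (Bxi v, gxxi v, gyxi v))))%:E <=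
    ((1 - a) * energy u + a * (3 * sg ^+ 2 / lam))%:E)%E.
  apply: le_trans (energy_step_mean_le A1 A2 u eta_rho) _.
  rewrite -/lam lee_fin /a etaM2 eta2 le_eqVlt; apply/orP; left; apply/eqP.
  by field; rewrite !gt_eqF.
have mE : measurable_fun setT (@energy R n m).
  by apply: measurable_energy; exact: measurable_id.
have zK : (\int[P]_w (energy (z K w))%:E <=
    ((1 - a) ^+ K * energy (x0, y0) + 3 * sg ^+ 2 / lam)%:E)%E.
  apply: (@chain_mean_le _ _ _ _ _ _ _ _ _ Pxi P
    (fun w => (Bxi w, gxxi w, gyxi w)) (fun t w => (B t w, gx t w, gy t w))
    F (x0, y0) z (@energy R n m) (1 - a) (a * (3 * sg ^+ 2 / lam))) => //.
  - exact: energy_ge0.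
  - by rewrite subr_ge0.
  - apply: mulr_ge0 => //; rewrite /a etaM2; apply: mulr_ge0; last exact: ltW.
    by rewrite divr_ge0 // invr_ge0 ltW.
  - by rewrite subKr.
rewrite expectation.unlock; under eq_integral do rewrite !enorm2E.
apply: le_trans zK _; rewrite lee_fin lerD2r !enorm2E.
apply: ler_wpM2r; first exact: (energy_ge0 (x0, y0)).
rewrite -/a (_ : - (a * K%:R) = K%:R * - a); last by rewrite mulrN mulrC.
rewrite expRM_natl; apply: lerXn2r.
- by rewrite nnegrE subr_ge0.
- by rewrite nnegrE expR_ge0.
- exact: expR_ge1Dx.
Qed.
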